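(* For every fixed $n\in\mathbb{N}_0$ the set $\mathcal{U}_n$ is the universe of a model for RST whose individuals are the sets $A\in\mathcal{U}_n$ and in which $\in$ is interpreted as the true membership relation between these individuals (and equality as true equality).
   Context: All sets are pure sets; the background theory is ZFC (with regularity and choice). For a set $A$ let $\mathcal{P}^0(A)=A$, $\mathcal{P}^{k}(A)=\mathcal{P}(\mathcal{P}^{k-1}(A))$ for $k\ge1$, and $\mathcal{SP}(A)=\bigcup_{k=0}^\infty\mathcal{P}^k(A)$, where $\mathcal{P}$ is the power set operation. Define $$V_{0,0}=\mathcal{SP}(\emptyset),\quad V_{n,k}=\mathcal{SP}(V_{n,k-1})\ (n\in\mathbb{N}_0,\ k\in\mathbb{N}),\quad \mathcal{U}_n=\bigcup_{k=0}^\infty V_{n,k}\ (n\in\mathbb{N}_0),\quad V_{n,0}=\mathcal{SP}(\mathcal{U}_{n-1})\ (n\in\mathbb{N}),$$ with $\mathbb{N}=\{1,2,3,\ldots\}$ and $\mathbb{N}_0=\mathbb{N}\cup\{0\}$. RST is the first-order theory with equality in the language with the single binary predicate $\in$ and the following axioms (free variables are read universally) for all choices of distinct variables $t,u,v,w,x,y,z$; $\mathrm{var}(F)$ denotes the set of all variables occurring in $F$: A1 $\forall y\,(y\in u\leftrightarrow y\in v)\to u=v$. A2 $\exists u\,\forall y\,(y\in u\leftrightarrow (y\in x\wedge F))$ for all formulas $F$ with $u,x\notin\mathrm{var}(F)$. A3 $\exists y\,y\in u\to\exists y\,(y\in u\wedge\neg\exists z\,(z\in u\wedge z\in y))$. A4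 $\exists u\,(x\in u\wedge y\in u)$. A5 $\exists u\,[\,x\in u\ \wedge\ \forall y(y\in u\to\forall z(z\in y\to z\in u))\ \wedge\ \forall y(y\in u\to\exists z(z\in u\wedge\forall v(v\in z\leftrightarrow\forall w(w\in v\to w\in y))))\ \wedge\ \forall y(y\in u\to\forall z(z\in u\to\exists v(v\in u\wedge (y\in v\wedge z\in v)\wedge\forall w(w\in v\to\forall t(t\in w\to t\in v)))))\,]$. A6 $\forall x(x\in u\to\exists w\,w\in x)\to\bigl[\forall x\forall y(x\in u\to(y\in u\to(\exists w(w\in x\wedge w\in y)\to x=y)))\to\exists y\forall x(x\in u\to\exists v((v\in x\wedge v\in y)\wedge\forall w((w\in x\wedge w\in y)\to v=w)))\bigr]$. *)

(* Defs.v *)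
From HB Require Import structures.
From mathcomp Require Import all_boot boolp.

Set Implicit Arguments.
Unset Strict Implicit.
Unset Printing Implicit Defensive.

Local Open Scope quotient_scope.

(** Pure sets are Aczel's well-founded trees modulo extensional equality, so
    that Leibniz equality on [zset] is equality of sets.  The axioms of ZFC,
    proved below as [zset_*], show that [zset] is a universe of set theory
    (with replacement for arbitrary functions on [zset]). *)

Inductive tree : Type := Node (A : Type) of A -> tree.

Definition arity (s : tree) : Type := let: Node A _ := s in A.
Definition child (s : tree) : arity s -> tree :=
  let: Node _ f := s in f.

Fixpoint tree_eq (s t : tree) : Prop :=
  match s, t with
  | Node A f, Node B g =>
      (forall a, exists b, tree_eq (f a) (g b)) /\
      (forall b, exists a, tree_eq (f a) (g b))
  end.

Lemma tree_eq_refl s : tree_eq s s.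
Proof. by elim: s => A f IH; split=> a; exists a. Qed.

Lemma tree_eq_sym s t : tree_eq s t -> tree_eq t s.
Proof.
elim: s t => A f IH [B g] /= [H1 H2]; split=> [b|a].
  by have [a /IH] := H2 b; exists a.
by have [b /IH] := H1 a; exists b.
Qed.

Lemma tree_eq_trans t s r : tree_eq s t -> tree_eq t r -> tree_eq s r.
Proof.
elim: s t r => A f IH [B g] [C h] /= [H1 H2] [K1 K2]; split=> [a|c].
  have [b Hab] := H1 a; have [c Hbc] := K1 b.
  by exists c; apply: IH Hab Hbc.
have [b Hbc] := K2 c; have [a Hab] := H2 b.
by exists a; apply: IH Hab Hbc.
Qed.

HB.instance Definition _ := gen_eqMixin tree.
HB.instance Definition _ := gen_choiceMixin tree.

Definition tree_eqb : rel tree := fun s t => `[< tree_eq s t >].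

Lemma tree_eqb_refl : reflexive tree_eqb.
Proof. by move=> s; apply/asboolP/tree_eq_refl. Qed.

Lemma tree_eqb_sym : symmetric tree_eqb.
Proof. by move=> s t; apply/asboolP/asboolP; apply: tree_eq_sym. Qed.

Lemma tree_eqb_trans : transitive tree_eqb.
Proof.
move=> t s r /asboolP st /asboolP tr; apply/asboolP.
exact: tree_eq_trans st tr.
Qed.

Canonical tree_equiv : equiv_rel tree :=
  EquivRel tree_eqb tree_eqb_refl tree_eqb_sym tree_eqb_trans.

Definition zset : Type := {eq_quot tree_equiv}.

(** [family F] is the set [{F i | i : I}]; every set [A] is the family [@el A]
    indexed by [idx A]. *)

Definition family (I : Type) (F : I -> zset) : zset :=
  \pi_({eq_quot tree_equiv}) (Node (fun i => repr (F i))).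

Definition idx (A : zset) : Type := arity (repr A).
Definition el (A : zset) (i : idx A) : zset :=
  \pi_({eq_quot tree_equiv}) (child i).

Definition zmem (A B : zset) : Prop := exists i : idx B, el i = A.

Declare Scope zset_scope.
Delimit Scope zset_scope with zset.
Bind Scope zset_scope with zset.
Notation "A ∈ B" := (zmem A B) (at level 70, no associativity) : zset_scope.
Local Open Scope zset_scope.

Definition zsubset (A B : zset) : Prop := forall x, x ∈ A -> x ∈ B.
Definition empty : zset := family (fun i : False => match i with end).
Definition upair (A B : zset) : zset :=
  family (fun b : bool => if b then A else B).
Definition sep (P : zset -> Prop) (A : zset) : zset :=
  family (fun i : {i : idx A | P (el i)} => el (sval i)).
Definition powerset (A : zset) : zset :=
  family (fun P : idx A -> Prop => family (fun i : {i | P i} => el (sval i))).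
Definition union (A : zset) : zset :=
  family (fun p : {i : idx A & idx (el i)} => el (projT2 p)).
Definition bigcup (F : nat -> zset) : zset := union (family F).

Lemma tree_eq_arity (s t : tree) : tree_eq s t <->
  (forall a : arity s, exists b : arity t, tree_eq (child a) (child b)) /\
  (forall b : arity t, exists a : arity s, tree_eq (child a) (child b)).
Proof. by case: s t => [A f] [B g]. Qed.

Lemma pi_eqP (s t : tree) :
  \pi_({eq_quot tree_equiv}) s = \pi_({eq_quot tree_equiv}) t
    <-> tree_eq s t.
Proof.
split=> [/eqmodP/asboolP //|st].
by apply/eqmodP/asboolP.
Qed.

Lemma mem_pi (t : tree) (A : zset) :
  A ∈ \pi_({eq_quot tree_equiv}) t <->
  exists a : arity t, \pi_({eq_quot tree_equiv}) (child a) = A.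
Proof.
have /tree_eq_arity[H1 H2] : tree_eq (repr (\pi_({eq_quot tree_equiv}) t)) t.
  by apply/pi_eqP; rewrite reprK.
split=> [[i <-]|[a <-]].
  by have [a Ha] := H1 i; exists a; apply/pi_eqP/tree_eq_sym.
by have [i Hi] := H2 a; exists i; apply/pi_eqP.
Qed.

Lemma mem_family (I : Type) (F : I -> zset) (A : zset) :
  A ∈ family F <-> exists i, F i = A.
Proof.
rewrite mem_pi /=; split=> -[i].
  by rewrite reprK; exists i.
by exists i; rewrite reprK.
Qed.

Lemma zset_extensionality (A B : zset) :
  (forall x, x ∈ A <-> x ∈ B) -> A = B.
Proof.
move=> AB; rewrite -[A]reprK -[B]reprK; apply/pi_eqP/tree_eq_arity.
split=> [a|b].
  have /AB[b Hb] : el a ∈ A by exists a.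
  by exists b; apply/pi_eqP.
have /AB[a Ha] : el b ∈ B by exists b.
by exists a; apply/pi_eqP.
Qed.

Lemma zset_ind (P : zset -> Prop) :
  (forall A, (forall x, x ∈ A -> P x) -> P A) -> forall A, P A.
Proof.
move=> H A; rewrite -[A]reprK; elim: (repr A) => {A} I f IH.
by apply: H => x /mem_pi[i <-].
Qed.

Lemma zset_regularity (A : zset) :
  (exists x, x ∈ A) -> exists x, x ∈ A /\ ~ exists y, y ∈ A /\ y ∈ x.
Proof.
move=> [x xA]; apply: contrapT => noA.
elim/zset_ind: x xA => x IH xA; apply: noA; exists x; split=> // -[y [yA yx]].
exact: IH yA.
Qed.

Lemma mem_empty (x : zset) : ~ x ∈ empty.
Proof. by move/mem_family => -[]. Qed.

Lemma zset_pairing (A B x : zset) : x ∈ upair A B <-> x = A \/ x = B.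
Proof.
rewrite mem_family; split=> [[[] <-]|[->|->]].
- by left.
- by right.
- by exists true.
- by exists false.
Qed.

Lemma zset_separation (P : zset -> Prop) (A x : zset) :
  x ∈ sep P A <-> x ∈ A /\ P x.
Proof.
rewrite mem_family; split=> [[[i Pi] <-]|[[i <-] Pi]].
  by split=> //; exists i.
by exists (exist _ i Pi).
Qed.

Lemma zset_union (A x : zset) : x ∈ union A <-> exists y, y ∈ A /\ x ∈ y.
Proof.
rewrite mem_family; split=> [[[i j] <-]|[y [[i <-] [j <-]]]].
  by exists (el i); split; [exists i|exists j].
by exists (existT _ i j).
Qed.

Lemma zset_powerset (A x : zset) : x ∈ powerset A <-> zsubset x A.
Proof.
rewrite mem_family; split=> [[P <-] y /mem_family[[i Pi] <-]|xA].
  by exists i.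
exists (fun i => el i ∈ x); apply: zset_extensionality => y.
rewrite mem_family; split=> [[[i Pi] <-] //|yx].
have [i iy] := xA y yx; subst y.
by exists (exist (fun i => el i ∈ x) i yx).
Qed.

Lemma zset_replacement (G : zset -> zset) (A : zset) :
  exists B, forall y, y ∈ B <-> exists x, x ∈ A /\ G x = y.
Proof.
exists (family (fun i : idx A => G (el i))) => y; rewrite mem_family.
split=> [[i <-]|[x [[i <-] <-]]]; last by exists i.
by exists (el i); split=> //; exists i.
Qed.

Lemma zset_infinity : exists A, empty ∈ A /\
  forall x, x ∈ A -> union (upair x (upair x x)) ∈ A.
Proof.
pose S x := union (upair x (upair x x)).
exists (family (fun n : nat => iter n S empty)); split.
  by apply/mem_family; exists 0.
by move=> x /mem_family[n <-]; apply/mem_family; exists n.+1.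
Qed.

Lemma zset_choice (A : zset) :
  (forall x, x ∈ A -> exists y, y ∈ x) ->
  (forall x y, x ∈ A -> y ∈ A -> (exists z, z ∈ x /\ z ∈ y) -> x = y) ->
  exists C, forall x, x ∈ A -> exists ! y, y ∈ x /\ y ∈ C.
Proof.
move=> ne disj.
have [g gP] : {g : zset -> zset & forall x, x ∈ A -> g x ∈ x}.
  apply: (@boolp.choice zset zset (fun x y => x ∈ A -> y ∈ x)) => x.
  have [xA|nxA] := pselect (x ∈ A).
    by have [y yx] := ne x xA; exists y.
  by exists x.
have [C CP] := zset_replacement g A.
exists C => x xA; exists (g x); split.
  by split; [exact: gP|apply/CP; exists x].
move=> y [yx /CP[z [zA gz]]]; subst y.
by rewrite (disj x z) //; exists (g z); split=> //; exact: gP.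
Qed.

Lemma mem_bigcup (F : nat -> zset) (x : zset) :
  x ∈ bigcup F <-> exists k, x ∈ F k.
Proof.
rewrite zset_union; split=> [[y [/mem_family[k <-] xk]]|[k xk]].
  by exists k.
by exists (F k); split=> //; apply/mem_family; exists k.
Qed.

Definition SP (A : zset) : zset := bigcup (fun k => iter k powerset A).

(** [V n k] is the [k]-th iterate of [SP] at V_{n,0}; the recursion equations
    for V_{n,k} are [V00], [VnS] and [VS0]. *)
Fixpoint V (n : nat) : nat -> zset :=
  fun k => iter k SP (if n is m.+1 then SP (bigcup (V m)) else SP empty).

Definition U (n : nat) : zset := bigcup (V n).

Lemma V00 : V 0 0 = SP empty.
Proof. by []. Qed.

Lemma VnS n k : V n k.+1 = SP (V n k).
Proof. by case: n. Qed.

Lemma VS0 n : V n.+1 0 = SP (U n).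
Proof. by []. Qed.

(** Variables are named by natural numbers, bound variables included. *)

Inductive formula : Type :=
  | FMem of nat & nat
  | FEq of nat & nat
  | FNot of formula
  | FAnd of formula & formula
  | FOr of formula & formula
  | FImp of formula & formula
  | FIff of formula & formula
  | FAll of nat & formula
  | FEx of nat & formula.

Declare Scope formula_scope.
Delimit Scope formula_scope with fml.
Bind Scope formula_scope with formula.
Notation "x ∈ y" := (FMem x y) (at level 70, no associativity) : formula_scope.
Notation "x ≡ y" := (FEq x y) (at level 70, no associativity) : formula_scope.
Notation "¬ F" := (FNot F) (at level 75, right associativity) : formula_scope.
Notation "F ∧ G" := (FAnd F G) (at level 80, right associativity) : formula_scope.
Notation "F ∨ G" := (FOr F G) (at level 85, right associativity) : formula_scope.
Notation "F → G" := (FImp F G)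
  (at level 99, G at level 200, right associativity) : formula_scope.
Notation "F ↔ G" := (FIff F G) (at level 95, no associativity) : formula_scope.
Notation "∀ x , F" := (FAll x F)
  (at level 10, x at level 9, F at level 200) : formula_scope.
Notation "∃ x , F" := (FEx x F)
  (at level 10, x at level 9, F at level 200) : formula_scope.

Fixpoint var (F : formula) : seq nat :=
  match F with
  | FMem x y | FEq x y => [:: x; y]
  | FNot G => var G
  | FAnd G H | FOr G H | FImp G H | FIff G H => var G ++ var H
  | FAll x G | FEx x G => x :: var G
  end.

Definition update (D : Type) (s : nat -> D) (x : nat) (d : D) : nat -> D :=
  fun y => if y == x then d else s y.

Fixpoint sat (D : Type) (E : D -> D -> Prop) (s : nat -> D) (F : formula) :
    Prop :=
  match F with
  | FMem x y => E (s x) (s y)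
  | FEq x y => s x = s y
  | FNot G => ~ sat E s G
  | FAnd G H => sat E s G /\ sat E s H
  | FOr G H => sat E s G \/ sat E s H
  | FImp G H => sat E s G -> sat E s H
  | FIff G H => sat E s G <-> sat E s H
  | FAll x G => forall d, sat E (update s x d) G
  | FEx x G => exists d, sat E (update s x d) G
  end.

Definition theory : Type := formula -> Prop.

(** Free variables of the axioms are read universally. *)
Definition is_model (D : Type) (E : D -> D -> Prop) (T : theory) : Prop :=
  inhabited D /\ forall F, T F -> forall s : nat -> D, sat E s F.

Local Open Scope formula_scope.

(** [var F] also contains the bound variables; in [A2], [y] may occur in [F]. *)
Inductive RST : theory :=
  | A1 (u v y : nat) of uniq [:: u; v; y] :
      RST ((∀ y, (y ∈ u ↔ y ∈ v)) → u ≡ v)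
  | A2 (u x y : nat) (F : formula) of
      uniq [:: u; x; y] & u \notin var F & x \notin var F :
      RST (∃ u, ∀ y, (y ∈ u ↔ (y ∈ x ∧ F)))
  | A3 (u y z : nat) of uniq [:: u; y; z] :
      RST ((∃ y, y ∈ u) →
           ∃ y, (y ∈ u ∧ ¬ ∃ z, (z ∈ u ∧ z ∈ y)))
  | A4 (u x y : nat) of uniq [:: u; x; y] :
      RST (∃ u, (x ∈ u ∧ y ∈ u))
  | A5 (t u v w x y z : nat) of uniq [:: t; u; v; w; x; y; z] :
      RST (∃ u,
        (x ∈ u
        ∧ (∀ y, (y ∈ u → ∀ z, (z ∈ y → z ∈ u)))
        ∧ (∀ y, (y ∈ u →
             ∃ z, (z ∈ u ∧ ∀ v, (v ∈ z ↔ ∀ w, (w ∈ v → w ∈ y)))))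
        ∧ (∀ y, (y ∈ u → ∀ z, (z ∈ u →
             ∃ v, (v ∈ u ∧ (y ∈ v ∧ z ∈ v)
                   ∧ ∀ w, (w ∈ v → ∀ t, (t ∈ w → t ∈ v))))))))
  | A6 (u v w x y : nat) of uniq [:: u; v; w; x; y] :
      RST ((∀ x, (x ∈ u → ∃ w, w ∈ x)) →
           ((∀ x, ∀ y, (x ∈ u → (y ∈ u →
               ((∃ w, (w ∈ x ∧ w ∈ y)) → x ≡ y)))) →
            ∃ y, ∀ x, (x ∈ u →
              ∃ v, ((v ∈ x ∧ v ∈ y)
                    ∧ ∀ w, ((w ∈ x ∧ w ∈ y) → v ≡ w))))).

Local Close Scope formula_scope.

Definition individuals (A : zset) : Type := {x : zset | x ∈ A}.

Definition true_mem (A : zset) (x y : individuals A) : Prop :=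
  sval x ∈ sval y.

Arguments is_model : clear implicits.
Arguments true_mem : clear implicits.

(* Main.v *)
From mathcomp Require Import all_boot boolp.
Require Import Defs.

(** Why [U n] is a model.  Everything rests on one property of the sets
    V_{n,k}, called [stage] below: such a set is transitive, closed under the
    power set operation, and any two of its elements lie in a transitive
    element of it.  These are exactly the three clauses that A5 demands of its
    witness.  Each V_{n,k} is [SP A] for a transitive set [A] (the empty set,
    the preceding V_{n,k-1}, or U_{n-1}), and the iterated power sets of a
    transitive set form an increasing chain of transitive sets, each an element
    of the next; hence their union [SP A] is a stage ([stage_SP]).

    The set [U n] is the union of the increasing chain of the stages V_{n,k},
    and every subset of V_{n,k} belongs to V_{n,k+1}.  So [U n] is transitive,
    and any two of its elements lie in a common stage all of whose subsets
    belong to [U n].  Any nonempty set [M] with these properties models RST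
    ([stages_model_RST]): transitivity makes extensionality, regularity and the
    notion of subset absolute, so A1 and A3 are inherited from the universe.
    The stage itself witnesses A4 and A5, and its subsets provide the sets
    asserted to exist by A2 and A6. *)

Set Implicit Arguments.
Unset Strict Implicit.
Unset Printing Implicit Defensive.

Local Open Scope zset_scope.

(** * Stages *)

Definition ztransitive (A : zset) : Prop := forall x, x ∈ A -> zsubset x A.

Record stage (u : zset) : Prop := Stage {
  stage_trans : ztransitive u;
  stage_powerset : forall y, y ∈ u -> powerset y ∈ u;
  stage_directed : forall y z, y ∈ u -> z ∈ u ->
    exists v, [/\ v ∈ u, y ∈ v, z ∈ v & ztransitive v]
}.

Lemma zsubset_refl A : zsubset A A.
Proof. by []. Qed.

Lemma mem_powerset_self A : A ∈ powerset A.
Proof. exact/zset_powerset/zsubset_refl. Qed.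

Lemma zsubset_powerset A : ztransitive A -> zsubset A (powerset A).
Proof. by move=> At x /At xA; apply/zset_powerset. Qed.

Lemma ztransitive_powerset A : ztransitive A -> ztransitive (powerset A).
Proof.
by move=> At x /zset_powerset xA y /xA; apply: zsubset_powerset.
Qed.

Lemma ztransitive_bigcup F :
  (forall k, ztransitive (F k)) -> ztransitive (bigcup F).
Proof.
move=> Ft x /mem_bigcup[k xk] y yx; apply/mem_bigcup; exists k.
exact: Ft yx.
Qed.

Lemma zsubset_chain (F : nat -> zset) :
  (forall k, zsubset (F k) (F k.+1)) ->
  forall j k, j <= k -> zsubset (F j) (F k).
Proof.
move=> Finc j k /subnK <-; elim: (k - j) => [|m IH] // x /IH.
exact: Finc.
Qed.

Lemma ztransitive_iter_powerset A k :
  ztransitive A -> ztransitive (iter k powerset A).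
Proof. by move=> At; elim: k => [|k IH] //=; apply: ztransitive_powerset. Qed.

Lemma zsubset_iter_powerset A j k :
  ztransitive A -> j <= k ->
  zsubset (iter j powerset A) (iter k powerset A).
Proof.
move=> At; apply: (@zsubset_chain (fun i => iter i powerset A)) => i.
exact/zsubset_powerset/ztransitive_iter_powerset.
Qed.

Lemma iter_powerset_SP A k : iter k powerset A ∈ SP A.
Proof. by apply/mem_bigcup; exists k.+1; apply: mem_powerset_self. Qed.

(** For [y] in P^k(A), transitivity gives [powerset y] as a subset of
    P^{k+1}(A), hence an element of P^{k+2}(A).  Two elements of [SP A] occur
    together in some P^k(A), which is itself a transitive element of [SP A]. *)
Lemma stage_SP A : ztransitive A -> stage (SP A).
Proof.
move=> At; have Pt k := @ztransitive_iter_powerset A k At.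
split; first exact: ztransitive_bigcup.
- move=> y /mem_bigcup[k yk]; apply/mem_bigcup; exists k.+2.
  apply/zset_powerset => z /zset_powerset zy; apply/zset_powerset => w /zy.
  exact: Pt.
- move=> y z /mem_bigcup[j yj] /mem_bigcup[k zk].
  exists (iter (maxn j k) powerset A); split=> //.
  + exact: iter_powerset_SP.
  + exact: zsubset_iter_powerset (leq_maxl j k) _ yj.
  + exact: zsubset_iter_powerset (leq_maxr j k) _ zk.
Qed.

(** * The hierarchy *)

Lemma stage_V n k : stage (V n k).
Proof.
elim: n k => [|n IHn] k.
  elim: k => [|k IHk]; last by rewrite VnS; apply/stage_SP/stage_trans.
  by rewrite V00; apply: stage_SP => x /mem_empty.
elim: k => [|k IHk]; last by rewrite VnS; apply/stage_SP/stage_trans.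
by rewrite VS0; apply/stage_SP/ztransitive_bigcup => k; case: (IHn k).
Qed.

Lemma zsubset_V_S n k : zsubset (V n k) (V n k.+1).
Proof. by move=> x xV; rewrite VnS; apply/mem_bigcup; exists 0. Qed.

Lemma powerset_V_U n k : zsubset (powerset (V n k)) (U n).
Proof.
move=> x xV; apply/mem_bigcup; exists k.+1.
by rewrite VnS; apply/mem_bigcup; exists 1.
Qed.

Lemma ztransitive_U n : ztransitive (U n).
Proof. by apply: ztransitive_bigcup => k; case: (stage_V n k). Qed.

Lemma pair_in_V n x y : x ∈ U n -> y ∈ U n -> exists k, x ∈ V n k /\ y ∈ V n k.
Proof.
move=> /mem_bigcup[j xj] /mem_bigcup[k yk]; exists (maxn j k).
have Vle := zsubset_chain (@zsubset_V_S n).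
by split; [apply: Vle (leq_maxl j k) _ xj|apply: Vle (leq_maxr j k) _ yk].
Qed.

(** * Satisfaction *)

(** In A2 the set [u] being defined must not occur in the defining formula [F];
    this lemma lets the value of [u] be forgotten when [F] is evaluated. *)
Lemma eq_sat (D : Type) (E : D -> D -> Prop) (F : formula) (s t : nat -> D) :
  {in var F, s =1 t} -> sat E s F <-> sat E t F.
Proof.
have update_agree x G (r r' : nat -> D) d : {in x :: var G, r =1 r'} ->
    {in var G, update r x d =1 update r' x d}.
  move=> rr' y yG; rewrite /update; case: eqP => // _.
  by apply: rr'; rewrite inE yG orbT.
have agree_l (G H : seq nat) (r r' : nat -> D) :
    {in G ++ H, r =1 r'} -> {in G, r =1 r'}.
  by move=> rr' y yG; apply: rr'; rewrite mem_cat yG.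
have agree_r (G H : seq nat) (r r' : nat -> D) :
    {in G ++ H, r =1 r'} -> {in H, r =1 r'}.
  by move=> rr' y yH; apply: rr'; rewrite mem_cat yH orbT.
elim: F s t => [x y|x y|G IHG|G IHG H IHH|G IHG H IHH|G IHG H IHH|G IHG H IHH
               |x G IHG|x G IHG] s t /= st.
- by rewrite !st ?inE ?eqxx ?orbT.
- by rewrite !st ?inE ?eqxx ?orbT.
- by rewrite (IHG s t).
- by rewrite (IHG s t) ?(IHH s t) //; [exact: agree_r st|exact: agree_l st].
- by rewrite (IHG s t) ?(IHH s t) //; [exact: agree_r st|exact: agree_l st].
- by rewrite (IHG s t) ?(IHH s t) //; [exact: agree_r st|exact: agree_l st].
- by rewrite (IHG s t) ?(IHH s t) //; [exact: agree_r st|exact: agree_l st].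
- have e d := IHG _ _ (update_agree x G s t d st).
  by split=> H d; apply/(e d).
- have e d := IHG _ _ (update_agree x G s t d st).
  by split=> -[d /(e d) H]; exists d.
Qed.

(** Evaluates the assignments in a goal, using the pairwise distinctness of the
    variables provided by the top assumption [uniq _]. *)
Ltac eval_vars :=
  rewrite /= ?inE ?negb_or ?andbT; move=> vars_distinct;
  repeat match goal with
  | H : is_true (_ && _) |- _ => case/andP: H => ? ?
  end;
  rewrite /= /update ?eqxx;
  repeat match goal with
  | H : is_true (?a != ?b) |- context [?a == ?b] => rewrite (negbTE H)
  | H : is_true (?a != ?b) |- context [?b == ?a] =>
      rewrite (eq_sym b a) (negbTE H)
  end;
  rewrite /true_mem /=.

(** * Models of RST *)

Definition individual (M x : zset) (xM : x ∈ M) : individuals M :=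
  exist _ x xM.

(** The hypothesis on pairs of elements of [M] is used with both elements equal
    wherever a stage around a single set suffices. *)
Lemma stages_model_RST (M : zset) :
  (exists x, x ∈ M) -> ztransitive M ->
  (forall x y, x ∈ M -> y ∈ M ->
     exists u, [/\ stage u, x ∈ u, y ∈ u & zsubset (powerset u) M]) ->
  is_model (individuals M) (true_mem M) RST.
Proof.
move=> [x0 x0M] Mt Mstage; split; first exact: (inhabits (individual x0M)).
have ind_eq (a b : individuals M) : sval a = sval b -> a = b.
  by case: a b => [a aM] [b bM] /= ab; subst b; rewrite (Prop_irrelevance aM bM).
move=> F [{F}u v y | {F}u x y F | {F}u y z | {F}u x y | {F}t u v w x y z
         | {F}u v w x y].
- eval_vars => s uv; apply/ind_eq/zset_extensionality => a.
  by split=> aM; apply/(uv (individual (Mt _ (svalP (s _)) _ aM))).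
- move=> uxy uF xF s.
  have [m [ms xm _ mM]] := Mstage _ _ (svalP (s x)) (svalP (s x)).
  (* Separation in the universe takes a predicate on all sets, so membership in
     [M] is made part of the predicate defined by [F]. *)
  pose P a := exists aM : a ∈ M, sat (true_mem M) (update s y (individual aM)) F.
  have xPM : sep P (sval (s x)) ∈ M.
    apply/mM/zset_powerset => a /zset_separation[ax _].
    exact: (stage_trans ms) xm _ ax.
  have satP d : sat (true_mem M)
      (update (update s u (individual xPM)) y d) F <-> P (sval d).
    have -> : sat (true_mem M) (update (update s u (individual xPM)) y d) F
              <-> sat (true_mem M) (update s y d) F.
      apply: eq_sat => z zF; rewrite /update; case: eqP => // _.
      by case: eqP => // zu; rewrite -zu zF in uF.
    split=> [H|[aM H]]; first by case: d H => a aM H; exists aM.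
    by rewrite (_ : d = individual aM) //; apply: ind_eq.
  move: uxy; eval_vars.
  exists (individual xPM) => d; rewrite satP.
  exact: zset_separation.
- eval_vars => s [a au].
  have [b [bu bP]] : exists b, b ∈ sval (s u) /\
      ~ exists c, c ∈ sval (s u) /\ c ∈ b.
    by apply: zset_regularity; exists (sval a).
  exists (individual (Mt _ (svalP (s u)) _ bu)); split=> // -[c [cu cb]].
  by apply: bP; exists (sval c).
- eval_vars => s.
  have [m [_ xm ym mM]] := Mstage _ _ (svalP (s x)) (svalP (s y)).
  by exists (individual (mM _ (mem_powerset_self m))).
- eval_vars => s.
  have [m [ms xm _ mM]] := Mstage _ _ (svalP (s x)) (svalP (s x)).
  have mt := stage_trans ms.
  have mem_M a : a ∈ m -> a ∈ M.
    by apply: Mt; apply: mM; apply: mem_powerset_self.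
  exists (individual (mM _ (mem_powerset_self m))); split=> //=; split; [|split].
  + by move=> a am b; apply: mt.
  + move=> a am; have pm := stage_powerset ms am.
    exists (individual (mem_M _ pm)); split=> //= b.
    rewrite zset_powerset; split=> [ba c|ba c cb]; first exact: ba.
    exact: (ba (individual (Mt _ (svalP b) _ cb))).
  + move=> a am b bm.
    have [c [cm ac bc ct]] := stage_directed ms am bm.
    exists (individual (mem_M _ cm)); split=> //=; split=> // d dc e.
    exact: ct dc _.
- eval_vars => s ne disj.
  have [m [ms um _ mM]] := Mstage _ _ (svalP (s u)) (svalP (s u)).
  have lift a : a ∈ sval (s u) -> a ∈ M by exact: Mt (svalP (s u)) _.
  have [C CP] : exists C, forall x, x ∈ sval (s u) ->
      exists ! y, y ∈ x /\ y ∈ C.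
    apply: zset_choice => [a au|a b au bu [c [ca cb]]].
      by have [c ca] := ne (individual (lift _ au)) au; exists (sval c).
    have cM : c ∈ M by exact: Mt (lift _ au) _ ca.
    have H := disj (individual (lift _ au)) (individual (lift _ bu)) au bu.
    by have [] : individual (lift _ au) = individual (lift _ bu) :> individuals M
      by apply: H; exists (individual cM).
  (* Elements of elements of [u] already lie in the stage [m], so restricting
     the choice set to [m] loses nothing and brings it into [M]. *)
  have CM : sep (fun a => a ∈ C) m ∈ M.
    by apply/mM/zset_powerset => a /zset_separation[].
  exists (individual CM) => a au.
  have [b [[ba bC] bU]] := CP _ au.
  exists (individual (Mt _ (svalP a) _ ba)); split=> /=.
    split=> //; apply/zset_separation; split=> //.
    exact: (stage_trans ms) ((stage_trans ms) _ um _ au) _ ba.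
  move=> d [da /zset_separation[_ dC]].
  by apply: ind_eq; apply: bU.
Qed.

Theorem theorem5p1 (n : nat) :
  is_model (individuals (U n)) (true_mem (U n)) RST.
Proof.
apply: stages_model_RST; last 1 first.
- move=> x y xU yU; have [k [xV yV]] := pair_in_V xU yU.
  by exists (V n k); split=> //; [exact: stage_V|exact: powerset_V_U].
- by exists (V n 0); apply: (@powerset_V_U n 0); apply: mem_powerset_self.
- exact: ztransitive_U.
Qed.
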